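(* Let $R$ be a Mori domain. If $R$ is stable, then $R$ has (Krull) dimension one. If $R$ is $w$-stable, then $R$ has $t$-dimension one.
   Context: Let $R$ be an integral domain with field of fractions $K$. An ideal of $R$ means a nonzero fractional ideal; it is integral if it is contained in $R$. For $R$-submodules $I,J$ of $K$, $(J:I):=\{x\in K: xI\subseteq J\}$. For an ideal $I$: $I^v:=(R:(R:I))$; $I^t:=\bigcup\{J^v : J\subseteq I \text{ a finitely generated ideal}\}$; $I^w:=\bigcap_{M\in t\text{-}\mathrm{Max}(R)}IR_M$, where $t\text{-}\mathrm{Max}(R)$ is the set of maximal elements among the proper integral ideals with $I=I^t$ (they are prime). $R$ is Mori if it satisfies the ascending chain condition on integral ideals with $I=I^v$. The $t$-dimension of $R$ is the supremum of the lengths $n$ of chains $(0)\subsetneq P_1\subsetneq\dots\subsetneq P_n$ with all $P_i$ nonzero prime ideals satisfying $P_i=P_i^t$. $R$ is stable if each ideal $I$ is invertible in $E:=(I:I)$, i.e. $I(E:I)=E$. $R$ is $w$-stable if for each ideal $I$, with $E:=(I^w:I^w)$, one has $(I^w(E:I^w))^w=E$ ($w$ being the operation of $R$; fractional ideals of $E$ are fractional ideals of $R$).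
   Formalization: The Mori domain R is assumed not to be a field: a field is Mori, stable and w-stable but has Krull dimension and t-dimension zero, so the claim fails for every field. *)

(* Defs.v *)
From HB Require Import structures.
From mathcomp Require Import all_boot all_order all_algebra.
From mathcomp Require Import ring_quotient fraction.
From mathcomp Require Import boolp classical_sets.

Set Implicit Arguments.
Unset Strict Implicit.
Unset Printing Implicit Defensive.

Import Order.TTheory GRing.Theory.
Local Open Scope classical_set_scope.
Local Open Scope ring_scope.

Section FractionalIdeals.
Variable R : idomainType.
Local Notation K := {fraction R}.
Local Notation "x %:F" := (FracField.tofrac x : K).

Implicit Types (I J M : set K).

Definition baseR : set K := range (@FracField.tofrac R).

Definition is_submodule I : Prop :=
  [/\ I 0, forall x y, I x -> I y -> I (x + y)
    & forall (r : R) x, I x -> I (r%:F * x)].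

(* In this theory "ideal" means nonzero fractional ideal. *)
Definition is_ideal I : Prop :=
  [/\ is_submodule I, exists2 x, I x & x != 0
    & exists2 d : R, d != 0 & forall x, I x -> baseR (d%:F * x)].

Definition is_integral_ideal I : Prop := is_ideal I /\ I `<=` baseR.

Definition span (s : seq K) : set K :=
  [set x | exists c : 'I_(size s) -> R, x = \sum_(i < size s) (c i)%:F * s`_i].

Definition is_fg_ideal I : Prop := is_ideal I /\ exists s : seq K, I = span s.

(* (J : I), computed in K *)
Definition colon J I : set K := [set x | forall y, I y -> J (x * y)].

(* the product I J: all finite sums of products x y with x in I, y in J *)
Definition ideal_mul I J : set K :=
  [set z | exists n (x y : 'I_n -> K),
     [/\ forall i, I (x i), forall i, J (y i) & z = \sum_(i < n) x i * y i]].

Definition v_op I : set K := colon baseR (colon baseR I).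

Definition t_op I : set K :=
  \bigcup_(J in [set J | is_fg_ideal J /\ J `<=` I]) v_op J.

Definition proper_integral_t_ideal M : Prop :=
  [/\ is_integral_ideal M, M <> baseR & M = t_op M].

Definition t_Max : set (set K) :=
  [set M | proper_integral_t_ideal M /\
     forall J, proper_integral_t_ideal J -> M `<=` J -> J = M].

(* R_M, as a subset of K; M is a subset of K, hence the test on s%:F *)
Definition localization M : set K :=
  [set x | exists a s : R, ~ M s%:F /\ x = a%:F / s%:F].

Definition w_op I : set K :=
  \bigcap_(M in t_Max) ideal_mul I (localization M).

Definition mori : Prop :=
  forall I : nat -> set K,
    (forall n, is_integral_ideal (I n) /\ I n = v_op (I n)) ->
    (forall n, I n `<=` I n.+1) ->
  exists N, forall n, (N <= n)%N -> I n = I N.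

Definition stable : Prop :=
  forall I, is_ideal I ->
  let E := colon I I in ideal_mul I (colon E I) = E.

Definition w_stable : Prop :=
  forall I, is_ideal I ->
  let E := colon (w_op I) (w_op I) in
  w_op (ideal_mul (w_op I) (colon E (w_op I))) = E.

Definition is_prime (P : set R) : Prop :=
  idealr_closed [in P] /\ prime_idealr_closed [in P].

Definition is_t_prime (P : set R) : Prop :=
  [/\ is_prime P, P <> [set 0]
    & let I := [set x%:F | x in P] in I = t_op I].

(* Only the first n+1 values of P matter. *)
Definition strict_chain (n : nat) (P : nat -> set R) : Prop :=
  forall i, (i < n)%N -> P i `<` P i.+1.

(* As suprema in nat, the dimensions below are asserted to be finite. *)
Definition krull_dimension_is (d : nat) : Prop :=
  supremums
    [set n | exists P : nat -> set R,
       (forall i, (i <= n)%N -> is_prime (P i)) /\ strict_chain n P] d.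

Definition t_dimension_is (d : nat) : Prop :=
  supremums
    [set n | exists P : nat -> set R,
       [/\ P 0 = [set 0], forall i, (0 < i <= n)%N -> is_t_prime (P i)
         & strict_chain n P]] d.

Definition is_field : Prop := GRing.field_axiom R.

End FractionalIdeals.

Arguments mori R : clear implicits.
Arguments stable R : clear implicits.
Arguments w_stable R : clear implicits.
Arguments krull_dimension_is R d : clear implicits.
Arguments t_dimension_is R d : clear implicits.
Arguments is_field R : clear implicits.

(* Main.v *)
(* Localizing at the larger of two comparable nonzero primes [P < M] (or at a
   t-maximal ideal containing it) turns both statements into one: a Mori domain
   [R_M] in which every ideal [I] is invertible in [(I : I)] has no nonzero
   nonmaximal prime.
     Put [T := (P : P)], and consider the overrings [D] of [R_M], divisorial
   over [R_M], that carry a nonmaximal prime [Q] with [(Q : Q) = T]. They all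
   lie in [T], a fractional ideal, so by the Mori property there is a maximal
   [D]. By stability some proper divisorial ideal [N] of [D] strictly contains
   [Q]; with [E := (N : N)], the pair [(E, (Q : N))] has the same properties,
   so [E = D] and [N] is invertible in [D]. Since [Q] is prime, [(D : N)] lies
   in [T], hence so do all the powers [N^-k]; these form an ascending chain of
   divisorial modules which must stabilize, contradicting [N <> D]. *)

Require Import Defs.
From mathcomp Require Import all_boot all_algebra.
From mathcomp Require Import ring_quotient fraction boolp classical_sets ring.

Set Implicit Arguments.
Unset Strict Implicit.
Unset Printing Implicit Defensive.

Import GRing.Theory.
Local Open Scope classical_set_scope.
Local Open Scope ring_scope.

(** * Nonmaximal primes under stability *)

Section StablePairs.
Variable R : idomainType.
Local Notation K := {fraction R}.
Implicit Types A D E I J N P T X : set K.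

Lemma colonP J I x : colon J I x = (forall y, I y -> J (x * y)).
Proof. by []. Qed.

Lemma ideal_mul_mul I J x y : I x -> J y -> ideal_mul I J (x * y).
Proof.
move=> Ix Jy; exists 1%N, (fun=> x), (fun=> y); split=> //.
by rewrite big_ord1.
Qed.

Lemma ideal_mul0 I J : ideal_mul I J 0.
Proof.
by exists 0%N, (fun=> 0), (fun=> 0); split=> [[]|[]|] //; rewrite big_ord0.
Qed.

Lemma ideal_mulD I J x y :
  ideal_mul I J x -> ideal_mul I J y -> ideal_mul I J (x + y).
Proof.
move=> [m [a [b [Ia Jb ->]]]] [n [c [d [Ic Jd ->]]]].
pose glue u v (i : 'I_(m + n)) : K :=
  match split i with inl j => u j | inr j => v j end.
exists (m + n)%N, (glue a c), (glue b d); split.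
- by move=> i; rewrite /glue; case: (split i).
- by move=> i; rewrite /glue; case: (split i).
rewrite big_split_ord; congr (_ + _); apply: eq_bigr => i _.
  by rewrite /glue -[lshift n i]/(unsplit (inl i)) unsplitK.
by rewrite /glue -[rshift m i]/(unsplit (inr i)) unsplitK.
Qed.

Lemma ideal_mul_ind I J (A : K -> Prop) : A 0 ->
  (forall x y, A x -> A y -> A (x + y)) ->
  (forall x y, I x -> J y -> A (x * y)) ->
  forall z, ideal_mul I J z -> A z.
Proof.
move=> A0 AD AM z [n [x [y [Ix Jy ->]]]].
by apply: (big_ind A) => // i _; apply: AM.
Qed.

Definition is_subring D : Prop :=
  [/\ D 1, forall x y, D x -> D y -> D (x - y)
    & forall x y, D x -> D y -> D (x * y)].

Definition is_module D I : Prop :=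
  [/\ I 0, forall x y, I x -> I y -> I (x + y)
    & forall d x, D d -> I x -> I (d * x)].

Definition is_fractional D I : Prop :=
  [/\ is_module D I, exists2 x, I x & x != 0
    & exists d, [/\ D d, d != 0 & forall x, I x -> D (d * x)]].

Definition prime_in D P : Prop :=
  [/\ is_module D P, P `<=` D, ~ P 1
    & forall x y, D x -> D y -> P (x * y) -> P x \/ P y].

(* [X] ranges over all subsets of [K]: the intersections of the [x^-1 D]. *)
Definition divisorial D A : Prop := exists X, A = colon D X.

(** With [E := (I : I)], the product [I (E : I)] is an ideal of [E], so containing [1] means being
    equal to [E]. *)
Definition stable_over D : Prop :=
  forall I, is_fractional D I -> ideal_mul I (colon (colon I I) I) 1.

(** The Mori condition as a maximum condition: multiplication by [d] turns the members of [F] into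
    divisorial ideals of [D]. *)
Definition divisorial_acc D : Prop :=
  forall d, D d -> d != 0 -> forall F : set (set K), F !=set0 ->
  (forall A, F A -> [/\ divisorial D A, D `<=` A & forall x, A x -> D (d * x)]) ->
  exists2 A, F A & forall B, F B -> A `<=` B -> B = A.

Lemma subring0 D : is_subring D -> D 0.
Proof. by case=> D1 DB _; rewrite -(subrr 1); apply: DB. Qed.

Lemma subringD D x y : is_subring D -> D x -> D y -> D (x + y).
Proof.
move=> sD Dx Dy; have D0 := subring0 sD; case: sD => _ DB _.
by rewrite -[y]opprK -[- y]add0r; apply: (DB) => //; apply: (DB).
Qed.

Lemma subring_module D : is_subring D -> is_module D D.
Proof.
by move=> sD; split=> [|x y|]; [exact: subring0|exact: subringD|case: sD].
Qed.

Lemma module_sub D E I : D `<=` E -> is_module E I -> is_module D I.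
Proof. by move=> DE [I0 ID IM]; split=> // d x /DE; apply: IM. Qed.

Lemma colon_module D J X : is_module D J -> is_module D (colon J X).
Proof.
case=> J0 JD JM; split=> [y _|x y Jx Jy z Xz|d x Dd Jx z Xz].
- by rewrite mul0r.
- by rewrite mulrDl; apply: JD; [apply: Jx|apply: Jy].
- by rewrite -mulrA; apply: JM => //; apply: Jx.
Qed.

Lemma moduleN D I x : is_subring D -> is_module D I -> I x -> I (- x).
Proof.
move=> sD; have D0 := subring0 sD; case: sD => D1 DB _ [_ _ IM] Ix.
by rewrite -mulN1r; apply: IM => //; rewrite -sub0r; apply: DB.
Qed.

Lemma colon_subring D I : is_subring D -> is_module D I -> is_subring (colon I I).
Proof.
move=> sD mI; case: (mI) => I0 ID IM; split=> [y|x y Ex Ey z Iz|x y Ex Ey z Iz].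
- by rewrite mul1r.
- rewrite mulrBl; apply: ID; first exact: Ex.
  by apply: (moduleN sD mI); apply: Ey.
- by rewrite -mulrA; apply: Ex; apply: Ey.
Qed.

(** [((D : Y) : X) = (D : XY)], where [XY] is just the set of products. *)
Lemma divisorial_colon D A X : divisorial D A -> divisorial D (colon A X).
Proof.
move=> [Y ->]; exists [set z | exists x y, [/\ X x, Y y & z = x * y]].
apply/seteqP; split=> z; rewrite /= !colonP => zXY.
  by move=> _ [x [y [Xx Yy ->]]]; rewrite mulrA; apply: zXY.
by move=> x Xx y Yy; rewrite -mulrA; apply: zXY; exists x, y.
Qed.

Variable D0 : set K.
Hypotheses (sD0 : is_subring D0) (stD0 : stable_over D0).

(* The invariant of the argument: [P] is a nonmaximal prime of the overring [D]. *)
Definition good T D P : Prop :=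
  [/\ [/\ is_subring D, D0 `<=` D & divisorial D0 D],
      prime_in D P, colon P P = T
    & exists I, [/\ is_module D I, P `<=` I, I `<=` D, ~ I 1 & exists2 b, I b & ~ P b]].

Lemma good_colon T D P : good T D P -> D `<=` T.
Proof.
by move=> [_ [[_ _ PM] _ _ _] <- _] d Dd p Pp; apply: PM.
Qed.

(** * The passage from [(D, P)] to [((N : N), (P : N))] *)

Section Step.
Variables (T D P N : set K) (b d0 : K).
Hypotheses (gDP : good T D P) (mN : is_module D N) (PN : P `<=` N).
Hypotheses (ND : N `<=` D) (N1 : ~ N 1) (Nb : N b) (Pb : ~ P b).
Hypotheses (D0d0 : D0 d0) (d0_neq0 : d0 != 0) (d0T : forall x, T x -> D0 (d0 * x)).

Let sD : is_subring D. Proof. by case: gDP => [[]]. Qed.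
Let D0D : D0 `<=` D. Proof. by case: gDP => [[]]. Qed.
Let mP : is_module D P. Proof. by case: gDP => [_ []]. Qed.
Let PD : P `<=` D. Proof. by case: gDP => [_ []]. Qed.
Let P_prime x y : D x -> D y -> P (x * y) -> P x \/ P y.
Proof. by case: gDP => [_ [_ _ _ h] _ _]; apply: h. Qed.
Let PPT : colon P P = T. Proof. by case: gDP. Qed.
Let P_absorb x y : D x -> P y -> P (x * y). Proof. by case: mP => _ _; apply. Qed.

Let P_cancel x : D x -> P (x * b) -> P x.
Proof. by move=> Dx /(P_prime Dx (ND Nb)) []. Qed.

(** For [y] in [(D : N)] and [p] in [P], [y p] is in [D] and [(y p) b = (y b) p] is in [P];
    primality cancels [b]. *)
Lemma colon_primeT : colon D N `<=` T.
Proof.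
move=> y yN; rewrite -PPT => p Pp; apply: P_cancel; first exact/yN/PN.
by rewrite -mulrA (mulrC p) mulrA; apply: P_absorb => //; apply: yN.
Qed.

Lemma colon_NN_D : colon N N `<=` colon D N.
Proof. by move=> y yN n Nn; apply/ND/yN. Qed.

Lemma colon_NN_T : colon N N `<=` T.
Proof. exact: subset_trans colon_NN_D colon_primeT. Qed.

Lemma D_colon_NN : D `<=` colon N N.
Proof. by move=> d Dd n Nn; case: mN => _ _; apply. Qed.

(** Modules over the overring [D] become fractional over [D0] itself, so stability is only ever used
    for [D0]. *)
Lemma fractional_of_bounded I : is_module D I -> I b -> I `<=` T -> is_fractional D0 I.
Proof.
move=> mI Ib IT; split; first exact: module_sub mI.
  exists b => //; apply/eqP => b0; apply: Pb; rewrite b0.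
  by case: mP.
by exists d0; split=> // x /IT; apply: d0T.
Qed.

Lemma N_stable : ideal_mul N (colon (colon N N) N) 1.
Proof.
apply: stD0; apply: fractional_of_bounded => //.
exact: subset_trans ND (good_colon gDP).
Qed.

Let E := colon N N.
Let P' := colon P N.

Lemma P'E : P' `<=` E.
Proof. by move=> u uN n Nn; apply/PN/uN. Qed.

(** For [n] in [N], [(u n) b = n (u b)] is in [P], and [b] cancels. Membership in [(P : N)] is thus
    tested at [b] alone. *)
Lemma P'_mul_b u : E u -> P (u * b) -> P' u.
Proof.
move=> Eu ub n Nn; apply: P_cancel; first exact/ND/Eu.
by rewrite mulrAC mulrC; apply: P_absorb => //; apply: ND.
Qed.

Lemma mP' : is_module E P'.
Proof.
split=> [n _|x y xN yN n Nn|d x Ed xN n Nn].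
- by rewrite mul0r; case: mP.
- by rewrite mulrDl; case: mP => _ PA _; apply: PA; [apply: xN|apply: yN].
- by rewrite mulrAC mulrC; apply: xN; apply: Ed.
Qed.

Lemma P'_prime : prime_in E P'.
Proof.
split; [exact: mP'|exact: P'E|by move/(_ b Nb); rewrite mul1r|].
move=> u v Eu Ev uv.
have : P ((u * b) * (v * b)).
  have -> : u * b * (v * b) = b * (u * v * b) by ring.
  by apply: P_absorb; [exact: ND|exact: uv].
have Du : D (u * b) by apply/ND/Eu.
have Dv : D (v * b) by apply/ND/Ev.
by case/(P_prime Du Dv) => [/(P'_mul_b Eu)|/(P'_mul_b Ev)]; [left|right].
Qed.

(* Invertibility of [N] in [E] gives [P = P' N]. *)
Lemma colon_P'P' : colon P' P' = T.
Proof.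
rewrite -PPT; apply/seteqP; split=> x xP; last first.
  by move=> u uN n Nn; rewrite -mulrA; apply/xP/uN.
move=> p Pp; have [P0 PA _] := mP.
suff : P (x * p * 1) by rewrite mulr1.
apply: (ideal_mul_ind (A := fun z => P (x * p * z)) _ _ _ N_stable).
- by rewrite mulr0.
- by move=> y z Py Pz; rewrite mulrDr; apply: PA.
move=> n m Nn mE.
have -> : x * p * (n * m) = x * (m * p) * n by ring.
(* [m p] lies in [P' = (P : N)]: [m n'] is in [E], hence in [T = (P : P)], so [m n' p] is in [P]. *)
apply: (xP (m * p)) => // n' Nn'.
have := colon_NN_T (mE n' Nn'); rewrite -PPT => /(_ p Pp).
by rewrite mulrAC.
Qed.

Lemma good_step : divisorial D0 N -> good T E P'.
Proof.
move=> dN; have sE : is_subring E by exact: colon_subring mN.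
have [N0 NA NM] := mN.
split; [|exact: P'_prime|exact: colon_P'P'|].
  split=> //; last exact: divisorial_colon.
  exact: subset_trans D0D D_colon_NN.
have [P'0 P'A P'M] := mP'.
(* [N + P'] lies strictly between [P'] and [E]. If [1 = n + u], then [u = 1 - n] is in [D] and [u b]
   in [P], so [u] is in [P], hence in [N], and so is [1]. *)
exists [set z | exists n u, [/\ N n, P' u & z = n + u]]; split.
- split=> [|x y [n [u [Nn uN ->]]] [n' [u' [Nn' uN' ->]]]|d x Ed [n [u [Nn uN ->]]]].
  + by exists 0, 0; rewrite addr0; split.
  + exists (n + n'), (u + u'); rewrite addrACA.
    by split=> //; [apply: NA|apply: P'A].
  + exists (d * n), (d * u); rewrite mulrDr.
    by split=> //; [apply: Ed|apply: P'M].
- by move=> u uP; exists 0, u; rewrite add0r.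
- move=> _ [n [u [Nn uN ->]]]; apply: (subringD sE); last exact: P'E.
  by apply: D_colon_NN; apply: ND.
- move=> [n [u [Nn uN e]]]; apply: N1; rewrite e; apply: NA => //; apply: PN.
  have eu : u = 1 - n by rewrite e addrC addKr.
  apply: P_cancel; last exact: uN.
  by rewrite eu; case: sD => D1 DB _; apply: DB => //; apply: ND.
exists b; first by exists b, 0; rewrite addr0; split.
by move=> /(_ b Nb) /P_cancel bP; apply/Pb/bP/ND.
Qed.

Lemma bounded_colon_powers : E = D -> divisorial_acc D0 -> False.
Proof.
move=> ED acc; have sND := N_stable; rewrite -/E ED in sND.
(* [A k] is [N^-k], as [N] is invertible in [D]. *)
pose A k := iter k (fun B => colon B N) D.
have mA k : is_module D (A k).
  by elim: k => [|k IH]; [exact: subring_module|exact: colon_module].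
have dA k : divisorial D0 (A k).
  by elim: k => [|k IH]; [case: gDP => [[]]|exact: divisorial_colon].
have Asub k : A k `<=` A k.+1.
  move=> x Ax n Nn; rewrite mulrC; case: (mA k) => _ _; apply=> //; exact: ND.
have DA k : D `<=` A k.
  by elim: k => [|k IH] //; apply: subset_trans (Asub k).
have sT : is_subring T by rewrite -PPT; exact: colon_subring mP.
(* As [1] is a sum of products [n m] with [n] in [N] and [m] in [(D : N)], [y] is a sum of terms
   [(y n) m], with [y n] in [A k] and [m] in [T]. *)
have AT k : A k `<=` T.
  elim: k => [|k IH]; first exact: good_colon gDP.
  move=> y yN; rewrite -[y]mulr1.
  apply: (ideal_mul_ind (A := fun z => T (y * z)) _ _ _ sND).
  - by rewrite mulr0; apply: subring0.
  - by move=> u v Tu Tv; rewrite mulrDr; apply: subringD.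
  - move=> n m Nn /colon_primeT Tm; rewrite mulrA.
    by case: (sT) => _ _; apply=> //; apply/IH/yN.
have [||B [k _ <-] Bmax] :=
    acc d0 D0d0 d0_neq0 (fun B => exists2 k, True & A k = B).
- by exists (A 0%N), 0%N.
- move=> _ [k _ <-]; split=> //; first exact: subset_trans D0D (DA k).
  by move=> x /AT; apply: d0T.
have Ak : A k.+1 = A k by apply: Bmax => //; exists k.+1.
(* Equality descends: for [x] in [A k.+1], [x m] is in [A k.+2 = A k.+1], so [x m n] is in [A k],
   and [x] is a sum of such terms. *)
have : A 1%N = A 0%N.
  elim: k {Bmax} Ak => [//|k IH e]; apply: IH; apply/seteqP; split=> //.
  move=> x Ax; rewrite -[x]mulr1; have [A0 AA _] := mA k.
  apply: (ideal_mul_ind (A := fun z => A k (x * z)) _ _ _ sND).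
  - by rewrite mulr0.
  - by move=> u v Au Av; rewrite mulrDr; apply: AA.
  move=> n m Nn mN'; rewrite mulrCA mulrC.
  suff : A k.+1 (x * m) by apply.
  rewrite -e => n' Nn'; rewrite -mulrA mulrC.
  by case: (mA k.+1) => _ _; apply=> //; apply: mN'.
(* Now [(D : N) = D], so invertibility of [N] puts [1] in [N D = N]. *)
rewrite /A /= => DND; apply: N1; rewrite DND in sND.
apply: (ideal_mul_ind (A := N) _ _ _ sND); case: mN => // _ _ NM n m Nn Dm.
by rewrite mulrC; apply: NM.
Qed.

End Step.

(** [N] is the hull [(D : (D : I))] of an intermediate ideal [I]. Were [1] in it, [(D : I)] would
    lie in [D]; using this twice, so would [((I : I) : I)], and stability would put [1] in
    [I D = I]. *)
Lemma stable_divisorial_hull T D P d0 : good T D P ->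
    D0 d0 -> d0 != 0 -> (forall x, T x -> D0 (d0 * x)) ->
  exists N b, [/\ is_module D N, P `<=` N, N `<=` D, ~ N 1
    & [/\ N b, ~ P b & divisorial D0 N]].
Proof.
move=> gDP D0d0 d0_neq0 d0T.
have [[sD D0D dD] [mP PD P1 Pp] PPT [I [mI PI ID I1 [b Ib Pb]]]] := gDP.
have [D1 DB DM] := sD; have mD := subring_module sD.
exists (colon D (colon D I)), b.
have II x : I x -> colon D (colon D I) x by move=> Ix y; rewrite mulrC; apply.
split; last split=> //.
- exact: colon_module.
- by move=> x /PI/II.
- by move=> x /(_ 1); rewrite mulr1; apply=> y Iy; rewrite mul1r; apply: ID.
- move=> hull1.
  have DI_D : colon D I `<=` D by move=> y /hull1; rewrite mul1r.
  have fI : is_fractional D0 I.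
    apply: (fractional_of_bounded gDP Pb D0d0 d0_neq0 d0T) => //.
    exact: subset_trans ID (good_colon gDP).
  apply: I1; case: (mI) => I0 IA IM.
  apply: (ideal_mul_ind (A := I) _ _ _ (stD0 fI)) => // x y Ix yI.
  rewrite mulrC; apply: IM => //; apply: (DI_D) => z Iz.
  by apply: DI_D => t It; apply: ID; apply: yI.
- exact: II.
- exact: divisorial_colon.
Qed.

Theorem no_nonmaximal_prime P p : divisorial_acc D0 -> prime_in D0 P ->
  P p -> p != 0 ->
  (exists I, [/\ is_module D0 I, P `<=` I, I `<=` D0, ~ I 1 & exists2 b, I b & ~ P b]) ->
  False.
Proof.
move=> acc pP Pp p_neq0 exI; have [mP PD P1 _] := pP.
pose T := colon P P.
(* [p] is a common denominator of [T], hence of all rings in the family. *)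
have Tp x : T x -> D0 (p * x) by move=> /(_ p Pp) /PD; rewrite mulrC.
have D0p := PD _ Pp.
have D0E : D0 = colon D0 [set 1].
  apply/seteqP; split=> x Dx; first by move=> _ ->; rewrite mulr1.
  by have := Dx 1 erefl; rewrite mulr1.
have g0 : good T D0 P by split=> //; split=> //; exists [set 1].
have [||D [Q gDQ] Dmax] := acc p D0p p_neq0 (fun D => exists Q, good T D Q).
- by exists D0, P.
- move=> D [Q gDQ]; have [[]] := gDQ => *; split=> // x /(good_colon gDQ).
  exact: Tp.
have [N [b [mN QN ND N1 [Nb Qb dN]]]] := stable_divisorial_hull gDQ D0p p_neq0 Tp.
have gE := good_step gDQ mN QN ND N1 Nb Qb D0p p_neq0 Tp dN.
have ED : colon N N = D.
  by apply: Dmax; [exists (colon Q N)|exact: D_colon_NN].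
exact: bounded_colon_powers gDQ mN QN ND N1 Nb Qb D0p p_neq0 Tp ED acc.
Qed.

End StablePairs.

(** * Divisorial ideals of Mori domains *)

Section Localization.
Variable R : idomainType.
Local Notation K := {fraction R}.
Local Notation "x %:F" := (FracField.tofrac x : K).
Local Notation baseR := (baseR (R := R)).
Local Notation span := (@Defs.span R).
Implicit Types (A B I J M W X : set K).

Lemma base_frac (r : R) : baseR r%:F.
Proof. by exists r. Qed.

Lemma base_subring : is_subring baseR.
Proof.
split=> [|_ _ [a _ <-] [b _ <-]|_ _ [a _ <-] [b _ <-]].
- by exists 1; rewrite ?tofrac1.
- by exists (a - b); rewrite ?tofracB.
- by exists (a * b); rewrite ?tofracM.
Qed.

Lemma submoduleP I : is_submodule I <-> is_module baseR I.
Proof.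
split=> -[I0 IA IM]; split=> //; first by move=> _ x [r _ <-]; apply: IM.
by move=> r x; apply: IM; apply: base_frac.
Qed.

Lemma v_op_ge I : I `<=` v_op I.
Proof. by move=> x Ix y; rewrite mulrC; apply. Qed.

Lemma v_op_mono A B : A `<=` B -> v_op A `<=` v_op B.
Proof. by move=> AB x Ax y yB; apply: Ax => z /AB; apply: yB. Qed.

Lemma v_op_colon X : v_op (colon baseR X) = colon baseR X.
Proof.
apply/seteqP; split; last exact: v_op_ge.
by move=> x vx y Xy; apply: vx => z; rewrite mulrC; apply.
Qed.

Lemma v_op_idem I : v_op (v_op I) = v_op I.
Proof. exact: v_op_colon. Qed.

Lemma v_op_base : v_op baseR = baseR.
Proof.
apply/seteqP; split; last exact: v_op_ge.
move=> x /(_ 1); rewrite mulr1; apply=> y; rewrite mul1r.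
by apply.
Qed.

Lemma v_op_integral I : is_integral_ideal I -> is_integral_ideal (v_op I).
Proof.
move=> [[mI [x Ix x_neq0] _] IR].
have vR : v_op I `<=` baseR by rewrite -v_op_base; apply: v_op_mono.
split=> //; split; last by exists 1; rewrite ?oner_eq0 // => y /vR; rewrite tofrac1 mul1r.
  by apply/submoduleP/colon_module/subring_module/base_subring.
by exists x => //; apply: v_op_ge.
Qed.

Lemma module_integral_ideal I x : is_module baseR I -> I `<=` baseR -> I x -> x != 0 ->
  is_integral_ideal I.
Proof.
move=> mI IR Ix x_neq0; split=> //; split; first exact/submoduleP.
  by exists x.
by exists 1; rewrite ?oner_eq0 // => y /IR; rewrite tofrac1 mul1r.
Qed.

Lemma span_module (s : seq K) : is_module baseR (span s).
Proof.
apply/submoduleP; split=> [|_ _ [c ->] [e ->]|r _ [c ->]].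
- by exists (fun=> 0); rewrite big1 // => i _; rewrite tofrac0 mul0r.
- exists (fun i => c i + e i); rewrite -big_split; apply: eq_bigr => i _.
  by rewrite tofracD mulrDl.
- exists (fun i => r * c i); rewrite mulr_sumr; apply: eq_bigr => i _.
  by rewrite tofracM mulrA.
Qed.

Lemma mem_span (s : seq K) x : x \in s -> span s x.
Proof.
move=> xs; have lt_i : (index x s < size s)%N by rewrite index_mem.
exists (fun j => (j == Ordinal lt_i)%:R).
rewrite (bigD1 (Ordinal lt_i)) //= eqxx tofrac1 mul1r nth_index //.
by rewrite big1 ?addr0 // => j /negPf ->; rewrite tofrac0 mul0r.
Qed.

Lemma span_sub I (s : seq K) : is_module baseR I -> (forall x, x \in s -> I x) ->
  span s `<=` I.
Proof.
move=> [I0 IA IM] sI _ [c ->]; apply: (big_ind I) => // i _.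
by apply: IM; [exact: base_frac|apply/sI/mem_nth].
Qed.

Lemma v_closed_t_closed I : is_integral_ideal I -> I = v_op I -> I = t_op I.
Proof.
move=> [[/submoduleP mI [x0 Ix0 x0_neq0] _] IR] Iv; apply/seteqP; split=> x.
  (* The generator [x0] keeps the span nonzero when [x = 0]. *)
  move=> Ix; have sI : span [:: x; x0] `<=` I.
    by apply: span_sub => // y; rewrite !inE => /orP[] /eqP ->.
  exists (span [:: x; x0]); last by apply: v_op_ge; apply: mem_span; rewrite inE eqxx.
  split=> //; split; last by eexists.
  have [] // := @module_integral_ideal (span [:: x; x0]) x0; first exact: span_module.
    exact: subset_trans IR.
  by apply: mem_span; rewrite !inE eqxx orbT.
by move=> [J [_ JI] vJ]; rewrite Iv; apply: v_op_mono vJ.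
Qed.

Section Mori.
Hypothesis moriR : mori R.

Lemma mori_max (F : set (set K)) : F !=set0 ->
  (forall A, F A -> is_integral_ideal A /\ A = v_op A) ->
  exists2 A, F A & forall B, F B -> A `<=` B -> B = A.
Proof.
move=> [A0 FA0] Fv; apply: contrapT => noMax.
have next (A : {A | F A}) : {B : {A | F A} | sval A `<=` sval B /\ sval B <> sval A}.
  apply: cid; apply: contrapT => noB; apply: noMax; exists (sval A); first exact: svalP.
  move=> B FB AB; apply: contrapT => neqBA; apply: noB.
  by exists (exist _ B FB).
have [I [_ Istep]] := dependent_choice next (exist _ A0 FA0).
have [|n|N stat] := moriR (I := fun n => sval (I n)).
- by move=> n; apply/Fv/svalP.
- by case: (Istep n).
by case: (Istep N) => _; apply; apply: stat.
Qed.

(** A maximal v-closure of a finitely generated subideal absorbs every [x] in [B], since adjoining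
    [x] to the generators cannot enlarge it. The fixed [b] keeps the spans nonzero. *)
Lemma mori_fg B : is_integral_ideal B -> exists s : seq K,
  [/\ is_fg_ideal (span s), span s `<=` B & B `<=` v_op (span s)].
Proof.
move=> [[/submoduleP mB [b Bb b_neq0] _] BR].
have intS s : (forall x, x \in b :: s -> B x) -> is_integral_ideal (span (b :: s)).
  move=> sB; apply: (@module_integral_ideal _ b) => //; first exact: span_module.
    by apply: subset_trans BR; apply: span_sub.
  by apply: mem_span; rewrite inE eqxx.
pose F : set (set K) := fun A => exists2 s,
  forall x, x \in b :: s -> B x & A = v_op (span (b :: s)).
have [||_ [s sB ->] smax] := @mori_max F.
- by exists (v_op (span [:: b])), [::] => // x; rewrite inE => /eqP ->.
- by move=> _ [s sB ->]; rewrite v_op_idem; split=> //; apply/v_op_integral/intS.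
exists (b :: s); split.
- by split; [case: (intS s sB)|exists (b :: s)].
- exact: span_sub.
move=> x Bx; rewrite -(smax (v_op (span [:: b, x & s]))).
- by apply: v_op_ge; apply: mem_span; rewrite !inE eqxx orbT.
- exists (x :: s) => // y; rewrite !inE => /or3P[/eqP->|/eqP->|ys] //.
  by apply: sB; rewrite inE ys orbT.
apply: v_op_mono; apply: span_sub; first exact: span_module.
by move=> y ys; apply: mem_span; move: ys; rewrite !inE => /orP[->|->]; rewrite ?orbT.
Qed.

(** By [mori_fg] the v-closure of [I] is that of a finitely generated subideal, which already counts
    in [t_op I]. *)
Lemma t_closed_v_closed I : is_integral_ideal I -> I = t_op I -> I = v_op I.
Proof.
move=> iI It; apply/seteqP; split; first exact: v_op_ge.
have [s [fg sI Is]] := mori_fg iI; rewrite {2}It => x vx.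
by exists (span s) => //; rewrite -v_op_idem; apply: v_op_mono vx.
Qed.

Lemma t_Max_above I : is_integral_ideal I -> I = v_op I -> ~ I 1 ->
  exists2 M, t_Max M & I `<=` M.
Proof.
move=> iI Iv I1.
pose F : set (set K) := fun A => [/\ is_integral_ideal A, A = v_op A, ~ A 1 & I `<=` A].
have [||M [iM Mv M1 IM] Mmax] := @mori_max F.
- by exists I; split.
- by move=> A [].
exists M => //; split.
  split=> //; last exact: v_closed_t_closed.
  by move=> MR; apply: M1; rewrite MR; case: base_subring.
move=> J [iJ JR Jt] MJ; apply: Mmax => //; split=> //.
- exact: t_closed_v_closed.
- move=> J1; apply: JR; case: iJ => [[/submoduleP[_ _ JM] _ _] JR].
  apply/seteqP; split=> // x Rx; rewrite -[x]mulr1; exact: JM.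
exact: subset_trans MJ.
Qed.

Lemma t_Max_prime M : t_Max M -> prime_in baseR M.
Proof.
move=> [[iM MR Mt] Mmax]; have Mv := t_closed_v_closed iM Mt.
have [[/submoduleP mM [m Mm m_neq0] _] MsubR] := iM.
have [M0 MA MM] := mM; have sR := base_subring; have [R1 RB RM] := sR.
split=> //.
  move=> M1; apply: MR; apply/seteqP; split=> // x Rx.
  by rewrite -[x]mulr1; apply: MM.
move=> x y Rx Ry Mxy; case: (pselect (M x)) => Mx; [by left|right].
(* [J] is [(M : x)] intersected with [R], written as a colon by means of [M = (R : (R : M))], hence
   v-closed. It contains [M] and omits [1], so maximality gives [J = M]. *)
pose J := colon baseR ([set 1] `|` [set x * w | w in colon baseR M]).
have JE z : J z <-> baseR z /\ M (x * z).
  split=> [Jz|[Rz Mxz] _ [->|[w Mw <-]]].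
  - split; first by rewrite -[z]mulr1; apply: Jz; left.
    by rewrite Mv => w Mw; rewrite mulrAC mulrC; apply: Jz; right; exists w.
  - by rewrite mulr1.
  - by rewrite mulrA mulrC [z * x]mulrC; apply: Mw.
suff JM : J = M by rewrite -JM; apply/JE.
apply: Mmax; last by move=> z Mz; apply/JE; split; [apply: MsubR|apply: MM].
have JR : J `<=` baseR by move=> z /JE[].
have iJ : is_integral_ideal J.
  apply: (module_integral_ideal _ JR _ m_neq0); first exact/colon_module/subring_module.
  by apply/JE; split; [apply: MsubR|apply: MM].
split=> //; last by apply: v_closed_t_closed => //; rewrite v_op_colon.
by move=> JeR; have /JE[_] : J 1; [rewrite JeR|rewrite mulr1].
Qed.
End Mori.
End Localization.

(** * Localization at a prime *)

Section LocalizationAtPrime.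
Variable R : idomainType.
Local Notation K := {fraction R}.
Local Notation "x %:F" := (FracField.tofrac x : K).
Local Notation baseR := (baseR (R := R)).
Local Notation span := (@Defs.span R).
Implicit Types (A B I J W X : set K).

Variable M : set K.
Hypothesis pM : prime_in baseR M.

Let mM : is_module baseR M. Proof. by case: pM. Qed.
Let M1 : ~ M 1. Proof. by case: pM. Qed.

Let MM (s t : R) : ~ M s%:F -> ~ M t%:F -> ~ M (s * t)%:F.
Proof.
case: pM => _ _ _ h Ms Mt; rewrite tofracM => /h.
by case=> //; apply: base_frac.
Qed.

Let M_neq0 (s : R) : ~ M s%:F -> s%:F != 0.
Proof. by move=> Ms; apply/eqP => s0; apply: Ms; rewrite s0; case: mM. Qed.

(* For [I] inside [R] this is the extension of [I] to [R_M]. *)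
Definition saturation I : set K := [set x | exists2 s : R, ~ M s%:F & I (s%:F * x)].

Lemma localizationE : localization M = saturation baseR.
Proof.
apply/seteqP; split=> [_ [a [s [Ms ->]]]|x [s Ms [a _ sx]]].
  by exists s => //; rewrite mulrC divfK ?M_neq0 //; apply: base_frac.
exists a, s; split=> //; apply: (mulfI (M_neq0 Ms)).
by rewrite -sx mulrCA divff ?mulr1 ?M_neq0.
Qed.

Lemma saturation_ge I : I `<=` saturation I.
Proof. by move=> x Ix; exists 1; rewrite tofrac1 // mul1r. Qed.

Lemma localization1 : localization M 1.
Proof. by rewrite localizationE; apply: saturation_ge; case: (base_subring R). Qed.

Lemma saturation_module I : is_module baseR I -> is_module (saturation baseR) (saturation I).
Proof.
move=> [I0 IA IM]; split.
- exact: saturation_ge.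
- move=> x y [s Ms Ix] [t Mt Iy]; exists (s * t); first exact: MM.
  rewrite tofracM mulrDr {1}[s%:F * _]mulrC -!mulrA.
  by apply: IA; apply: IM => //; apply: base_frac.
- move=> d x [s Ms Rd] [t Mt Ix]; exists (s * t); first exact: MM.
  have -> : (s * t)%:F * (d * x) = (s%:F * d) * (t%:F * x).
    by rewrite tofracM; ring.
  exact: IM.
Qed.

Lemma local_subring : is_subring (saturation baseR).
Proof.
have mL := saturation_module (subring_module (base_subring R)).
have sR := base_subring R; have [R1 RB _] := sR.
have [_ LA LM] := mL; split=> [|x y Lx Ly|]; [exact: saturation_ge| |exact: LM].
apply: LA => //; rewrite -mulN1r; apply: LM => //; apply: saturation_ge.
by rewrite -sub0r; apply: RB => //; apply: subring0.
Qed.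

Lemma saturation_div I x (s : R) : is_module baseR I ->
  ~ M s%:F -> saturation I (s%:F * x) -> saturation I x.
Proof.
move=> [_ _ IM] Ms [t Mt Ix]; exists (t * s); first exact: MM.
by rewrite tofracM -mulrA.
Qed.

Lemma common_denominator (s : seq K) y :
  (forall x, x \in s -> saturation baseR (x * y)) ->
  exists2 t : R, ~ M t%:F & forall x, x \in s -> baseR (t%:F * (x * y)).
Proof.
have [_ _ RM] := base_subring R.
elim: s => [|z s IH] Ls; first by exists 1; rewrite ?tofrac1.
have [x xs|t Mt Rt] := IH; first by apply: Ls; rewrite inE xs orbT.
have [|u Mu Ru] := Ls z; first by rewrite inE eqxx.
exists (t * u); first exact: MM.
move=> x; rewrite inE tofracM => /orP[/eqP->|xs].
  by rewrite -mulrA; apply: RM => //; apply: base_frac.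
by rewrite mulrAC mulrC; apply: RM; [exact: base_frac|exact: Rt].
Qed.

(* For [A] divisorial over [R_M], the contraction of [a A] to [R] is a v-ideal:
   its v-closure is that of a finitely generated subideal, and finitely many
   elements of [R_M] have a common denominator. *)
Lemma local_acc : mori R -> divisorial_acc (saturation baseR).
Proof.
move=> moriR d [t Mt [a _ ta]] d_neq0 F [A0 FA0] Fdiv.
have sR := base_subring R; have [R1 RB RM] := sR.
have mR := subring_module sR; have mL := saturation_module mR.
have a_neq0 : a%:F != 0 by rewrite ta mulf_neq0 // M_neq0.
(* [a = t d] clears the denominator of [d], with [t] a unit of [R_M]. As [1] is in every [A] of [F],
   every trace contains [a]. *)
pose trace A : set K := [set x | baseR x /\ A (x / a%:F)].
have FM A : F A -> is_module baseR A.
  move=> FA; have [[X ->] _ _] := Fdiv A FA.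
  exact/(module_sub (@saturation_ge baseR))/colon_module.
have trV A : F A -> is_integral_ideal (trace A) /\ trace A = v_op (trace A).
  move=> FA; have [[X AX] LA _] := Fdiv A FA; have [A_0 AA AM] := FM A FA.
  have iA : is_integral_ideal (trace A).
    apply: (@module_integral_ideal _ _ a%:F) => //; last 1 first.
    - by split; [exact: base_frac|rewrite divff //; apply/LA/saturation_ge].
    - split=> [|x y [Rx Ax] [Ry Ay]|e x Re [Rx Ax]].
      + by split; [exact: subring0|rewrite mul0r].
      + by split; [exact: subringD|rewrite mulrDl; apply: AA].
      + by split; [exact: RM|rewrite -mulrA; apply: AM].
    - by move=> x [].
  split=> //; apply/seteqP; split; first exact: v_op_ge.
  have [s [_ sA As]] := mori_fg moriR iA.
  move=> z vz; have {vz} sz : v_op (span s) z.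
    by rewrite -v_op_idem; apply: v_op_mono vz.
  split; first by rewrite -(v_op_base R); apply: v_op_mono sz => x /sA[].
  rewrite AX => x Xx.
  have [y ys|u Mu Ru] := @common_denominator s (x / a%:F).
    have [_] : trace A y by apply/sA/mem_span.
    by rewrite AX => /(_ x Xx); rewrite mulrAC mulrA.
  (* [u x / a] sends the generators [s] into [R], so it lies in [(R : span s)], and [z] in the
     v-closure sends it into [R]. *)
  exists u => //; have := sz (u%:F * (x / a%:F)).
  have -> : z * (u%:F * (x / a%:F)) = u%:F * (z / a%:F * x) by ring.
  apply=> y ys; rewrite mulrC.
  have := @span_sub _ [set y | baseR (u%:F * (y * (x / a%:F)))] s.
  move=> /(_ _ _ y ys) /=; rewrite mulrCA; apply=> //.
  split=> [|v w Rv Rw|r v Rr Rv] /=.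
  - by rewrite mul0r mulr0; apply: subring0.
  - by rewrite mulrDl mulrDr; apply: subringD.
  - by rewrite -[r * v * _]mulrA mulrCA; apply: RM.
have [||_ [A FA <-] Amax] := mori_max moriR (F := [set trace A | A in F]).
- by exists (trace A0), A0.
- by move=> _ [A FA <-]; apply: trV.
exists A => // B FB AB; apply/seteqP; split=> // x Bx.
have [[X AX] _ _] := Fdiv A FA.
have [_ _ /(_ x Bx) [u Mu Rdx]] := Fdiv B FB.
have eBA : trace B = trace A.
  by apply: Amax; [exists B|move=> y [Ry Ay]; split=> //; apply: AB].
(* [u a x = t (u d x)] is in [R], so [u a x] is in [trace B = trace A]; hence [u x] is in [A], and
   [u] is a unit of [R_M]. *)
have [_] : trace A (u%:F * (a%:F * x)).
  rewrite -eBA; split.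
    by rewrite ta -mulrA mulrCA; apply: RM => //; apply: base_frac.
  have [_ _ BM] := FM B FB; rewrite [a%:F * x]mulrC mulrA mulfK //.
  by apply: BM => //; apply: base_frac.
rewrite [a%:F * x]mulrC mulrA mulfK // AX => Aux y Xy.
by apply: (saturation_div mR Mu); rewrite mulrA; apply: Aux.
Qed.

(** [W] lets one proof serve both hypotheses: it is [J] for stability and the w-closure of [J] for
    w-stability. A fractional ideal [I] of [R_M] is [J R_M], where [J] consists of its elements with
    denominator [a]. *)
Lemma local_stable :
  (forall J, is_ideal J -> exists W,
    [/\ J `<=` W, W `<=` ideal_mul J (localization M)
      & ideal_mul (ideal_mul W (colon (colon W W) W)) (localization M) 1]) ->
  stable_over (saturation baseR).
Proof.
rewrite localizationE => H I [mI [x Ix x_neq0] [d [[t Mt [a _ ta]] d_neq0 dI]]].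
have sR := base_subring R; have [R1 RB RM] := sR.
have mR := subring_module sR; have [I0 IA IM] := mI.
have a_neq0 : a%:F != 0 by rewrite ta mulf_neq0 // M_neq0.
have IMb : is_module baseR I := module_sub (@saturation_ge baseR) mI.
have I_div (s : R) y : ~ M s%:F -> I (s%:F * y) -> I y.
  move=> Ms Iy; rewrite -[y](mulKf (M_neq0 Ms)); apply: IM => //.
  by exists s => //; rewrite divff ?M_neq0.
pose J : set K := [set y | I y /\ baseR (a%:F * y)].
have IJ y : I y -> exists2 s : R, ~ M s%:F & J (s%:F * y).
  move=> Iy; have [s Ms Rs] := dI y Iy; exists s => //; split.
    by case: IMb => _ _; apply=> //; apply: base_frac.
  by rewrite ta -mulrA [d * _]mulrCA; apply: RM => //; apply: base_frac.
have iJ : is_ideal J.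
  split; last 1 first.
  - exists a; first by rewrite -tofrac_eq0.
    by move=> y [].
  - apply/submoduleP; split=> [|y z [Iy Ry] [Iz Rz]|r y Rr [Iy Ry]].
    + by split=> //; rewrite mulr0; apply: subring0.
    + by split; [exact: IA|rewrite mulrDr; apply: subringD].
    + by split; [case: IMb => _ _; apply|rewrite mulrCA; apply: RM].
  - have [s Ms Js] := IJ x Ix; exists (s%:F * x) => //.
    by rewrite mulf_neq0 // M_neq0.
have [W [JW WJ W1]] := H J iJ.
have WI : W `<=` I.
  move=> w /WJ; apply: ideal_mul_ind => // y l [Iy _] Ll.
  by rewrite mulrC; apply: IM.
apply: (ideal_mul_ind (A := ideal_mul I (colon (colon I I) I))) W1.
- exact: ideal_mul0.
- exact: ideal_mulD.
move=> y l Wy Ll; move: y Wy; apply: ideal_mul_ind.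
- by rewrite mul0r; apply: ideal_mul0.
- by move=> y z Iy Iz; rewrite mulrDl; apply: ideal_mulD.
move=> w e Ww We; rewrite -mulrA; apply: ideal_mul_mul; first exact: WI.
(* Clearing the denominators of [y] and [z] separately shows that [e l] is in [((I : I) : I)]. *)
move=> y /IJ[s Ms /JW Ws] z /IJ[u Mu /JW Wu].
apply: (I_div s) => //; apply: (I_div u) => //.
have -> : u%:F * (s%:F * (e * l * y * z)) = l * (e * (s%:F * y) * (u%:F * z)) by ring.
by apply: IM => //; apply/WI/We.
Qed.

(** [saturation M] is the proper ideal that makes [saturation P] nonmaximal in [R_M]. *)
Theorem no_prime_below P p b : stable_over (saturation baseR) -> mori R ->
  prime_in baseR P -> P `<=` M -> P p -> p != 0 -> M b -> ~ P b -> False.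
Proof.
move=> st moriR [mP PR P1 P_prime] PM Pp p_neq0 Mb Pb.
have sL := local_subring; have acc := local_acc moriR.
have sat I J : I `<=` J -> saturation I `<=` saturation J.
  by move=> IJ x [s Ms Is]; exists s => //; apply: IJ.
(* [P R_M] contracts back to [P]: denominators lie outside [M], hence outside [P]. *)
have sat_prime x : baseR x -> saturation P x -> P x.
  move=> Rx [s Ms]; case/(P_prime _ _ (base_frac s) Rx) => // Ps.
  by case: Ms; apply: PM.
have P_sat1 I : I `<=` M -> ~ saturation I 1.
  by move=> IM [s Ms]; rewrite mulr1 => /IM.
apply: (no_nonmaximal_prime sL st (P := saturation P) (p := p) acc) => //.
- split; [exact: saturation_module|exact: sat|exact: P_sat1|].
  move=> x y [s Ms Rx] [t Mt Ry] [u Mu Pxy].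
  have : P ((s%:F * x) * (t%:F * y)).
    apply: sat_prime; first by case: (base_subring R) => _ _; apply.
    exists u => //; have -> : u%:F * (s%:F * x * (t%:F * y)) =
      (s%:F * t%:F) * (u%:F * (x * y)) by ring.
    by case: mP => _ _; apply=> //; rewrite -tofracM; apply: base_frac.
  by case/(P_prime _ _ Rx Ry) => [Px|Py]; [left; exists s|right; exists t].
- exact: saturation_ge.
exists (saturation M); split.
- exact: saturation_module.
- exact: sat.
- by apply: sat; case: pM.
- exact: P_sat1.
- exists b; first exact: saturation_ge.
  by move=> /sat_prime Pb'; apply/Pb/Pb'; case: pM => _ + _ _; apply.
Qed.

End LocalizationAtPrime.

(** * Dimension *)

Section Dimension.
Variable R : idomainType.
Local Notation K := {fraction R}.
Local Notation "x %:F" := (FracField.tofrac x : K).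
Local Notation baseR := (baseR (R := R)).
Implicit Types (P Q : set R) (M : set K).

Lemma tofrac_image P x : [set y%:F | y in P] x%:F <-> P x.
Proof.
split=> [[y Py /eqP]|Px]; last by exists x.
by rewrite tofrac_eq => /eqP <-.
Qed.

Lemma is_prime_image P : is_prime P -> prime_in baseR [set x%:F | x in P].
Proof.
move=> [[P0 P1 PA] Pp]; split.
- split=> [|_ _ [x Px <-] [y Py <-]|_ _ [r _ <-] [x Px <-]].
  + by rewrite -(tofrac0 R); apply/tofrac_image; rewrite inE in P0.
  + rewrite -tofracD; apply/tofrac_image.
    by have := PA 1 x y; rewrite !inE mul1r; apply.
  + rewrite -tofracM; apply/tofrac_image.
    by have := PA r x 0; rewrite inE in P0; rewrite !inE addr0; apply.
- by move=> _ [x _ <-]; apply: base_frac.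
- by rewrite -(tofrac1 R) tofrac_image => P1'; move/negP: P1; apply; rewrite inE.
move=> _ _ [x _ <-] [y _ <-]; rewrite -tofracM !tofrac_image => Pxy.
by have := Pp x y; rewrite !inE => /(_ Pxy)/orP[]; rewrite inE; [left|right].
Qed.

Lemma prime_in_preimage M : prime_in baseR M -> is_prime [set x | M x%:F].
Proof.
move=> [[M0 MA MM] MR M1 Mp]; split; first split.
- by rewrite inE /= tofrac0.
- by apply/negP; rewrite inE /= tofrac1.
- move=> r x y; rewrite !inE /= => Mx My; rewrite tofracD tofracM.
  by apply: MA => //; apply: MM => //; apply: base_frac.
move=> x y; rewrite !inE /= tofracM => /Mp.
by case=> [||Mx|My]; try exact: base_frac; apply/orP; [left|right]; rewrite inE.
Qed.

Lemma base_image M : M `<=` baseR -> [set x%:F | x in [set x | M x%:F]] = M.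
Proof.
move=> MR; apply/seteqP; split=> [_ [x Mx <-] //|x Mx].
by have [r _ e] := MR _ Mx; exists r => //=; rewrite e.
Qed.

Lemma is_prime_set0 : is_prime [set 0 : R].
Proof.
split; first split.
- by rewrite inE.
- by apply/negP; rewrite inE /=; apply/eqP; rewrite oner_eq0.
- by move=> r x y; rewrite !inE /= => -> ->; rewrite mulr0 addr0.
move=> x y; rewrite !inE /= => /eqP; rewrite mulf_eq0.
by case/orP=> /eqP ->; apply/orP; [left|right]; rewrite inE.
Qed.

(** Supplies the lower bound on both dimensions: for a nonzero nonunit [a], the ideal [aR], written
    [(R : a^-1)], is divisorial and proper, so a t-maximal ideal contains it. *)
Lemma exists_t_prime : mori R -> ~ is_field R ->
  exists P : set R, is_t_prime P.
Proof.
move=> moriR nfR.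
have [a a_neq0 na] : exists2 a : R, a != 0 & a \isn't a GRing.unit.
  apply: contrapT => noa; apply: nfR => a a_neq0; apply: contrapT => /negP na.
  by apply: noa; exists a.
have sR := base_subring R; have [R1 _ RM] := sR.
have aF : a%:F != 0 by rewrite tofrac_eq0.
pose I : set K := colon baseR [set a%:F^-1].
have IP x : I x <-> baseR (x / a%:F).
  by split=> [|Rx _ -> //]; apply.
have iI : is_integral_ideal I.
  apply: (@module_integral_ideal _ _ a%:F) => //.
  - exact/colon_module/subring_module.
  - move=> x /IP Rx; rewrite -(divfK aF x).
    by apply: RM => //; apply: base_frac.
  - by apply/IP; rewrite divff.
have [||M tM IM] := t_Max_above moriR iI; first by rewrite v_op_colon.
  move=> /IP[r _]; rewrite mul1r => ra; move/negP: na; apply.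
  have ra1 : r * a = 1 by apply/eqP; rewrite -tofrac_eq tofracM ra mulVf // tofrac1.
  by apply/unitrP; exists r; rewrite [a * r]mulrC.
have pM := t_Max_prime moriR tM; have [_ MR _ _] := pM.
exists [set x | M x%:F]; split; first exact: prime_in_preimage.
  move=> M0; have : [set x | M x%:F] a by apply/IM/IP; rewrite divff.
  by rewrite M0 /=; apply/eqP.
by rewrite /= base_image //; case: tM => [[]].
Qed.

Lemma prime_neq0 P : is_prime P -> P <> [set 0] -> exists2 p, P p & p != 0.
Proof.
move=> [[P0 _ _] _] nP0; rewrite inE in P0; apply: contrapT => noP; apply: nP0.
apply/seteqP; split=> [p Pp|_ -> //]; apply/eqP; apply: contrapT => /negP p_neq0.
by apply: noP; exists p.
Qed.

(** Localization is at [Q] itself, with [W = J]: stability already gives [1] in [J (E : J)]. *)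
Lemma stable_no_chain P Q : mori R -> stable R ->
  is_prime P -> is_prime Q -> P <> [set 0] -> P `<` Q -> False.
Proof.
move=> moriR st pP pQ nP0 [PQ /existsNP[b /not_implyP[Qb Pb]]].
have [p Pp p_neq0] := prime_neq0 pP nP0.
have pM := is_prime_image pQ.
apply: (@no_prime_below _ _ pM [set x%:F | x in P] p%:F b%:F) => //.
- apply: local_stable => // J iJ; exists J.
  have L1 := localization1 pM.
  split=> // [x Jx|]; first by rewrite -[x]mulr1; apply: ideal_mul_mul.
  by rewrite -[1]mulr1; apply: ideal_mul_mul => //; rewrite (st J iJ) => y; rewrite mul1r.
- exact: is_prime_image.
- by move=> _ [x Px <-]; exists x => //; apply: PQ.
- exact/tofrac_image.
- by rewrite tofrac_eq0.
- exact/tofrac_image.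
- by rewrite tofrac_image.
Qed.

(** The w-operation sees only t-maximal ideals, so localization is at a t-maximal [M] containing
    [Q]. The term at [M] of the intersection [w_op] gives both that the w-closure of [J] lies in
    [J R_M] and that it is invertible locally. *)
Lemma w_stable_no_chain P Q : mori R -> w_stable R ->
  is_t_prime P -> is_t_prime Q -> P `<` Q -> False.
Proof.
move=> moriR wst [pP nP0 _] [pQ nQ0 tQ] [PQ /existsNP[b /not_implyP[Qb Pb]]].
have [p Pp p_neq0] := prime_neq0 pP nP0.
have [q Qq q_neq0] := prime_neq0 pQ nQ0.
have [mQ QR Q1 _] := is_prime_image pQ.
have iQ : is_integral_ideal [set x%:F | x in Q].
  by apply: (@module_integral_ideal _ _ q%:F) => //; [exact/tofrac_image|rewrite tofrac_eq0].
have [M tM QM] := t_Max_above moriR iQ (t_closed_v_closed moriR iQ tQ) Q1.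
have pM := t_Max_prime moriR tM.
apply: (@no_prime_below _ _ pM [set x%:F | x in P] p%:F b%:F) => //.
- apply: local_stable => // J iJ; exists (w_op J); split=> [x Jx N tN|x|].
  + by rewrite -[x]mulr1; apply: ideal_mul_mul => //; apply/localization1/t_Max_prime.
  + exact.
  + have : w_op (ideal_mul (w_op J) (colon (colon (w_op J) (w_op J)) (w_op J))) 1.
      by rewrite (wst J iJ) => y; rewrite mul1r.
    exact.
- exact: is_prime_image.
- by move=> _ [x Px <-]; apply: QM; exists x => //; apply: PQ.
- exact/tofrac_image.
- by rewrite tofrac_eq0.
- exact/QM/tofrac_image.
- by rewrite tofrac_image.
Qed.

End Dimension.

Theorem proposition4p1 (R : idomainType) (hR : mori R) (hnf : ~ is_field R) :
  (stable R -> krull_dimension_is R 1) /\ (w_stable R -> t_dimension_is R 1).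
Proof.
have [P [pP P0 tP]] := exists_t_prime hR hnf.
(* This chain serves both lower bounds. *)
have chain0 : strict_chain 1 (fun i => if i is 0%N then [set 0] else P).
  move=> [|//] _; have [[P_0 _ _] _] := pP; rewrite inE in P_0.
  split; first by move=> _ ->.
  by move=> P_sub; apply: P0; apply/seteqP; split=> // _ ->.
split=> st; split.
- move=> n [C [pC chC]]; case: (leqP n 1) => [//|n1]; exfalso.
  have [p0 [c0 c1]] := (pC 0%N isT, (chC 0%N (ltnW n1), chC 1%N n1)).
  (* [C 1] is nonzero, since the prime [C 0] contains [0] and is strictly smaller. *)
  apply: (stable_no_chain hR st (pC 1%N (ltnW n1)) (pC 2%N n1) _ c1) => C1.
  have [_] := c0; apply; rewrite C1 => _ ->.
  by have [[]] := p0; rewrite inE.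
- move=> u /(_ 1%N); apply; eexists; split; last exact: chain0.
  by move=> [|i] _; [exact: is_prime_set0|].
- move=> n [C [_ pC chC]]; case: (leqP n 1) => [//|n1]; exfalso.
  have t1 : is_t_prime (C 1%N) by apply: pC; apply: ltnW.
  have t2 : is_t_prime (C 2%N) by apply: pC.
  exact: w_stable_no_chain hR st t1 t2 (chC 1%N n1).
- move=> u /(_ 1%N); apply; eexists; split; last exact: chain0.
    by [].
  by move=> [|i].
Qed.
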